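(* Let $X$ be an upper-bound uc-semiring which is linearly ordered by its intrinsic order. The following statements are equivalent. (1) $X$ satisfies the following conditions, which are equivalent to each other for upper-bound uc-semirings: $X$ is Frobenius; $X$ is fully elementary; $X$ is $n$-elementary for some $n \in \mathbb{N}$ with $n\geq 2$; $X$ is $2$-elementary. (2) $X$ is supertropical. (3) $X$ is quasiidempotent. (4) $2 = 3$ in $X$.
   Context: $\mathbb{N} = \{0,1,2,\ldots\}$. A semiring $(X,+,0,\cdot)$ consists of a commutative monoid $(X,+,0)$ and a semigroup $(X,\cdot)$ such that $\cdot$ distributes over $+$ and $0\cdot x = x \cdot 0 = 0$ for all $x$. A uc-semiring is a semiring with a multiplicative unit $1$ and commutative multiplication. A natural number $n$ is viewed as the element $1+\cdots+1$ ($n$ times) of a unital semiring. The intrinsic order on a semiring $X$ is the preorder $a \leq b :\iff \exists x \in X,\ a + x = b$. A semiring is upper-bound if its intrinsic order is antisymmetric. It is linearly ordered if for all $x,y\in X$, $x \leq y$ or $y \leq x$. A uc-semiring $X$ is Frobenius if $(x+y)^n = x^n + y^n$ for all $x,y \in X$ and all $n \in \mathbb{N}$ with $n \geq 1$. A semiring $X$ is quasiidempotent when $x+x+x+x = x+x$ for all $x \in X$. Let $\nu\colon X \to X$, $\nu(x) := x+x$. A supertropical semiring is a quasiidempotent uc-semiring $X$ such that for all $a,b\in X$: if $\nu(a)\neq\nu(b)$ then $a+b\in\{a,b\}$; and if $\nu(a)=\nu(b)$ then $a+b=\nu(a)=\nu(b)$. A polynomial in $n$ variables over $X$ is a formal finite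 sum of monomials $a\, x_1^{d_1}\cdots x_n^{d_n}$ with $a \in X$, $d_i \in \mathbb{N}$ (up to order of summands and factors). A polynomial is symmetric when, for each monomial $a \prod_j x_j^{d_j}$ in it and each permutation $\sigma \in S_n$, the monomial $a\prod_j x_{\sigma(j)}^{d_j}$ also appears in it (i.e. the formal polynomial is invariant under permuting the variables; equivalently, it is an $X$-linear combination of minimal symmetric segments, where the minimal symmetric segment of $d \in \mathbb{N}^n$ is the sum, with each coefficient equal to $1$, of all distinct monomials obtained from $x_1^{d_1}\cdots x_n^{d_n}$ by permuting the variables). For $0\le k \leq n$, the elementary symmetric polynomial $\mathtt{el}_{n,k}(x_1,\ldots,x_n)$ is the sum of all products of $k$ distinct variables among $x_1,\ldots,x_n$. $X$ is $n$-elementary when for every symmetric polynomial $p$ in $n$ variables over $X$ there exists a polynomial $r$ in $n$ variables over $X$ such that $p(x_1,\ldots,x_n) = r\big(\mathtt{el}_{n,1}(x_1,\ldots,x_n),\ldots,\mathtt{el}_{n,n}(x_1,\ldots,x_n)\big)$ for all $x_1,\ldots,x_n \in X$ (equality of polynomial functions). $X$ is fully elementary when it is $n$-elementary for all $n \in \mathbb{N}$. *)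

(* Defs.v *)
From HB Require Import structures.
From mathcomp Require Import all_boot all_order all_fingroup all_algebra.
From mathcomp Require Import finmap.
From mathcomp.multinomials Require Import mpoly.

Set Implicit Arguments.
Unset Strict Implicit.
Unset Printing Implicit Defensive.

Import GRing.Theory.
Local Open Scope ring_scope.

(* A uc-semiring is a [comPzSemiRingType]; the trivial semiring (0 = 1) is
   included, and the natural number n in X is [n%:R]. *)

Definition intrinsic_le (X : comPzSemiRingType) (a b : X) : Prop :=
  exists x : X, a + x = b.

Definition upper_bound (X : comPzSemiRingType) : Prop :=
  forall a b : X, intrinsic_le a b -> intrinsic_le b a -> a = b.

Definition linearly_ordered (X : comPzSemiRingType) : Prop :=
  forall x y : X, intrinsic_le x y \/ intrinsic_le y x.

Definition frobenius (X : comPzSemiRingType) : Prop :=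
  forall (x y : X) (n : nat), (1 <= n)%N -> (x + y) ^+ n = x ^+ n + y ^+ n.

Definition quasiidempotent (X : comPzSemiRingType) : Prop :=
  forall x : X, x + x + x + x = x + x.

Definition nu (X : comPzSemiRingType) (x : X) : X := x + x.

Definition supertropical (X : comPzSemiRingType) : Prop :=
  [/\ quasiidempotent X,
      forall a b : X, nu a <> nu b -> a + b = a \/ a + b = b
    & forall a b : X, nu a = nu b -> a + b = nu a].

(* [{mpoly R[n]}] needs a coefficient ring with opposites, so formal
   polynomials over a semiring are given by their finitely supported
   coefficient functions on the exponent vectors ['X_{1..n}]. *)
Definition spoly (X : comPzSemiRingType) (n : nat) : Type :=
  {fsfun 'X_{1..n} -> X for fun=> 0}.

Definition seval (X : comPzSemiRingType) (n : nat) (p : spoly X n)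
    (x : 'I_n -> X) : X :=
  \sum_(m <- finsupp p) p m * \prod_(i < n) x i ^+ m i.

Definition ssymmetric (X : comPzSemiRingType) (n : nat) (p : spoly X n) : Prop :=
  forall (s : 'S_n) (m : 'X_{1..n}), p [multinom m (s i) | i < n] = p m.

Definition el (X : comPzSemiRingType) (n k : nat) (x : 'I_n -> X) : X :=
  \sum_(h : {set 'I_n} | #|h| == k) \prod_(i in h) x i.

(* The index i : 'I_n is 0-based: variable i of r receives el_{n,i+1}. *)
Definition n_elementary (X : comPzSemiRingType) (n : nat) : Prop :=
  forall p : spoly X n, ssymmetric p ->
    exists r : spoly X n,
      forall x : 'I_n -> X, seval p x = seval r (fun i : 'I_n => el i.+1 x).

Definition fully_elementary (X : comPzSemiRingType) : Prop :=
  forall n : nat, n_elementary X n.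

(* Main.v *)
(* If X is n-elementary with n >= 2, expressing x_1^m + ... + x_n^m through the
   elementary symmetric polynomials and setting all but one or two variables to
   0 gives (x + y)^m <= x^m + y^m, and the reverse inequality always holds.
   Conversely, let X be Frobenius and fix an exponent vector d0. With
   c_j = #{i | d0_i > j}, expand the product over j of el_{c_j} into monomials
   indexed by tuples of sets (h_j) with #h_j = c_j. The decreasing tuples
   h_j = {i | d_i > j} correspond to the distinct rearrangements d of d0, so
   they contribute the minimal symmetric segment of d0. Every other tuple is
   absorbed: if a lies in some h_j but not in h_k, and b in h_k but not in h_j,
   the Frobenius identity makes x^p y^q (p, q > 0) negligible against
   x^(p+q) + y^(p+q), which is what replacing a by b, or b by a, in all h_j
   containing only one of them produces. *)
Require Import Defs.
From mathcomp Require Import all_boot all_order all_fingroup all_algebra.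
From mathcomp Require Import finmap zify.
From mathcomp.multinomials Require Import mpoly.

Set Implicit Arguments.
Unset Strict Implicit.
Unset Printing Implicit Defensive.

Import GRing.Theory.
Local Open Scope ring_scope.

(** * The intrinsic order and absorption *)

Section IntrinsicOrder.

Variable X : comPzSemiRingType.
Implicit Types a b c d x y : X.

Lemma intrinsic_le_refl a : intrinsic_le a a.
Proof. by exists 0; rewrite addr0. Qed.

Lemma intrinsic_le_addr a b : intrinsic_le a (a + b).
Proof. by exists b. Qed.

Lemma intrinsic_leD a b c d :
  intrinsic_le a b -> intrinsic_le c d -> intrinsic_le (a + c) (b + d).
Proof. by move=> [u <-] [v <-]; exists (u + v); rewrite addrACA. Qed.

Lemma intrinsic_leM a b c d :
  intrinsic_le a b -> intrinsic_le c d -> intrinsic_le (a * c) (b * d).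
Proof.
move=> [u <-] [v <-]; exists (u * c + (a + u) * v).
by rewrite mulrDr !mulrDl -!addrA.
Qed.

Lemma intrinsic_leX a b n : intrinsic_le a b -> intrinsic_le (a ^+ n) (b ^+ n).
Proof.
move=> le_ab; elim: n => [|n IHn]; first exact: intrinsic_le_refl.
by rewrite !exprS; apply: intrinsic_leM.
Qed.

Lemma addr_expr_le_exprD a b n :
  (0 < n)%N -> intrinsic_le (a ^+ n + b ^+ n) ((a + b) ^+ n).
Proof.
case: n => // n _; rewrite exprDn big_ord_recl big_ord_recr /=.
rewrite subn0 expr0 mulr1 bin0 mulr1n subnn expr0 mul1r binn mulr1n.
by exists (\sum_(i < n) a ^+ (n.+1 - i.+1) * b ^+ i.+1 *+ 'C(n.+1, i.+1));
  rewrite -addrA [b ^+ _ + _]addrC.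
Qed.

Hypothesis X_ub : upper_bound X.

Lemma absorb_summand a b c : a + b + c = a -> a + b = a.
Proof. by move=> abc; apply: X_ub; [exists c | exists b]. Qed.

(** The cross term occurs in the binomial expansion of [(x + y) ^+ (p + q)] with coefficient at
    least 1. The Frobenius identity equates the expansion with its two end terms, and antisymmetry
    isolates one copy of the cross term. *)
Lemma frobenius_absorb x y p q : frobenius X -> (0 < p)%N -> (0 < q)%N ->
  x ^+ (p + q) + y ^+ (p + q) + x ^+ p * y ^+ q = x ^+ (p + q) + y ^+ (p + q).
Proof.
move=> frobX p_gt0 q_gt0; have lt_q: (q < (p + q).+1)%N by lia.
have /esym := frobX x y (p + q)%N (ltn_addr _ p_gt0).
rewrite exprDn (bigD1 ord0) //= (bigD1 ord_max) /=; last first.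
  by rewrite -val_eqE /=; lia.
rewrite (bigD1 (Ordinal lt_q)) /=; last by rewrite -!val_eqE /=; lia.
rewrite subn0 expr0 mulr1 bin0 mulr1n subnn expr0 mul1r binn mulr1n addnK.
have: (0 < 'C(p + q, q))%N by rewrite bin_gt0; lia.
case: 'C(p + q, q) => // k _; rewrite mulrS !addrA -!(addrA (_ + _ + _)).
by move/esym/absorb_summand.
Qed.

(** * Linear orders with [2 = 3] *)

Section LinearOrder.

Hypothesis X_lin : linearly_ordered X.
Hypothesis two_three : 2%:R = 3%:R :> X.

Lemma triple_double x : x + x + x = x + x.
Proof.
rewrite -addrA -[LHS]/(x *+ 3) -[RHS]/(x *+ 2).
by rewrite -(mulr_natl x 3) -two_three mulr_natl.
Qed.

Lemma double_exprn x n : (0 < n)%N -> (x + x) ^+ n = x ^+ n + x ^+ n.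
Proof.
move=> n_gt0; rewrite -mulr2n -mulr_natl exprMn -mulr2n -[RHS]mulr_natl.
congr (_ * _); case: n n_gt0 => // n _; elim: n => // n IHn.
by rewrite exprS IHn // mulr_natl mulr2n -[2%:R]/(1 + 1) !addrA !triple_double.
Qed.

(* Writing y = x + z, compare x with z: either z <= x, so that y is
   sandwiched between x and 2x, or z = x + w, and then x + y = 3x + w = y. *)
Lemma le_addr_dichotomy x y : intrinsic_le x y ->
  x + y = y \/ x + y = x + x /\ y + y = x + x.
Proof.
move=> le_xy; have [z yE] := le_xy.
have [[w zE]|le_zx] := X_lin x z.
  by left; rewrite -yE -zE !addrA triple_double.
have le_y2x: intrinsic_le y (x + x).
  by rewrite -yE; apply: intrinsic_leD => //; apply: intrinsic_le_refl.
right; split; apply: X_ub.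
- by rewrite -[X in intrinsic_le _ X]triple_double -addrA;
    apply: intrinsic_leD => //; apply: intrinsic_le_refl.
- by apply: intrinsic_leD => //; apply: intrinsic_le_refl.
- rewrite -[X in intrinsic_le _ X]triple_double.
  rewrite -[X in intrinsic_le _ (X + _)]triple_double -addrA.
  exact: intrinsic_leD.
- exact: intrinsic_leD.
Qed.

(** For [x <= y] the sum [x + y] is either [y] or [x + x]; its power is then [y ^+ n] or
    [x ^+ n + x ^+ n], since [2 ^ n = 2]. Both lie below [x ^+ n + y ^+ n]. *)
Lemma linear_frobenius : frobenius X.
Proof.
move=> x y n n_gt0; wlog le_xy: x y / intrinsic_le x y.
  by case: (X_lin x y) => le_xy IH; [|rewrite addrC [RHS]addrC]; apply: IH.
apply: X_ub; last exact: addr_expr_le_exprD.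
have le_xyn := intrinsic_leX n le_xy.
case: (le_addr_dichotomy le_xy) => [->|[-> _]].
  by rewrite addrC; apply: intrinsic_le_addr.
by rewrite double_exprn //; apply: intrinsic_leD => //;
  apply: intrinsic_le_refl.
Qed.

(** If [nu a = nu b] and [a <= b], then [a + b] is squeezed between [a + a] and [b + b]. If they
    differ, the dichotomy leaves only the case where the sum is the larger element. *)
Lemma linear_supertropical : supertropical X.
Proof.
have nuE a b: intrinsic_le a b -> nu a = nu b -> a + b = nu a.
  move=> le_ab eq_nu; apply: X_ub; [rewrite eq_nu|].
    by apply: intrinsic_leD => //; apply: intrinsic_le_refl.
  by apply: intrinsic_leD => //; apply: intrinsic_le_refl.
split=> [x|a b|a b eq_nu]; first by rewrite !triple_double.
  case: (X_lin a b) => /le_addr_dichotomy; rewrite /nu.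
    by case=> [-> _|[_ ->]] //; right.
  by rewrite [b + a]addrC; case=> [-> _|[_ ->]] //; left.
case: (X_lin a b) => /nuE; first exact.
by rewrite addrC eq_nu; apply.
Qed.

End LinearOrder.

Lemma quasiidempotent_two_three : quasiidempotent X -> 2%:R = 3%:R :> X.
Proof.
move=> /(_ 1) quasi; apply: X_ub; first by exists 1; rewrite natr1.
by exists 1; rewrite natr1 -[2%:R]/(1 + 1) -[RHS]quasi -!addrA.
Qed.

(** Squaring [1 + 1] gives [4 = 2], and 3 lies in between. *)
Lemma frobenius_two_three : frobenius X -> 2%:R = 3%:R :> X.
Proof.
move=> /(_ 1 1 2 isT); rewrite !expr2 mulr1 => frob.
apply: X_ub; first by exists 1; rewrite natr1.
by exists 1; rewrite natr1 -[RHS]frob -[RHS]/(2%:R * 2%:R) -natrM.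
Qed.

End IntrinsicOrder.

(** * Finitely supported polynomials and their evaluation *)

Section SemiringPolynomials.

Variables (X : comPzSemiRingType) (n : nat).
Local Open Scope fset_scope.

(** Several indices may share an exponent vector; their coefficients then add up. *)
Definition spoly_sum (I : finType) (a : I -> X) (m : I -> 'X_{1..n}) :
    spoly X n :=
  [fsfun d in [fset m i | i in I] => \sum_(i | m i == d) a i].

Lemma spoly_sumE (I : finType) (a : I -> X) (m : I -> 'X_{1..n}) d :
  spoly_sum a m d = \sum_(i | m i == d) a i.
Proof.
rewrite fsfun_fun; case: ifPn => // dN; rewrite big_pred0 // => i.
by apply: contraNF dN => /eqP <-; apply/imfsetP; exists i.
Qed.

Lemma seval_widen (p : spoly X n) (S : {fset 'X_{1..n}}) x :
  finsupp p `<=` S ->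
  seval p x = \sum_(m <- S) p m * \prod_(i < n) x i ^+ m i.
Proof.
move=> pS; apply: big_fset_incl => // m _ mp.
by rewrite fsfun_dflt // mul0r.
Qed.

Lemma seval_sum (I : finType) (a : I -> X) (m : I -> 'X_{1..n}) x :
  seval (spoly_sum a m) x = \sum_i a i * \prod_(j < n) x j ^+ m i j.
Proof.
pose S := [fset m i | i in I].
rewrite (@seval_widen _ S); last first.
  apply/fsubsetP => d; rewrite mem_finsupp fsfun_fun; case: ifP => //.
  by rewrite eqxx.
under eq_bigr do rewrite spoly_sumE big_distrl /=.
rewrite (exchange_big_dep xpredT) //=; apply: eq_bigr => i _.
have mS: m i \in S by apply/imfsetP; exists i.
rewrite big_mkcond (big_fsetD1 _ mS) /= eqxx.
rewrite -[RHS]addr0; apply: congr1; rewrite big_seq big1 // => d.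
by rewrite !inE eq_sym; case: eqP.
Qed.

(** The support fits in a finite box whose side [N] is the largest exponent occurring, so the
    monomials can be indexed by a finite type independent of [x]. *)
Lemma seval_bounded (p : spoly X n) :
  exists N, forall x, seval p x = \sum_(d : {ffun 'I_n -> 'I_N.+1})
    p [multinom d i : nat | i < n] * \prod_(i < n) x i ^+ d i.
Proof.
pose N := (\max_(m <- finsupp p) \max_(i < n) m i)%N; exists N => x.
pose mon (d : {ffun 'I_n -> 'I_N.+1}) := [multinom d i : nat | i < n].
have mon_inj: injective mon.
  move=> d d' /mnmP eq_d; apply/ffunP => i; apply/val_inj.
  by have := eq_d i; rewrite !mnmE.
rewrite (@seval_widen _ [fset mon d | d in {ffun 'I_n -> 'I_N.+1}]).
  rewrite big_imfset /=; last by move=> ? ? _ _; apply: mon_inj.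
  rewrite big_enum; apply: eq_bigr => d _; congr (_ * _).
  by apply: eq_bigr => i _; rewrite mnmE.
apply/fsubsetP => m mp; apply/imfsetP.
exists [ffun i => inord (m i)] => //; apply/mnmP => i.
rewrite mnmE ffunE inordK // ltnS.
apply: (@leq_trans (\max_(j < n) m j)%N); first exact: leq_bigmax.
exact: (@leq_bigmax_seq _ _ xpredT (fun m : 'X_{1..n} => \max_(j < n) m j)%N).
Qed.

Lemma seval_le (r : spoly X n) (x y : 'I_n -> X) :
  (forall i, intrinsic_le (x i) (y i)) -> intrinsic_le (seval r x) (seval r y).
Proof.
move=> le_xy.
apply: (big_ind2 (@intrinsic_le X)); first exact: intrinsic_le_refl.
  by move=> *; apply: intrinsic_leD.
move=> m _; apply: intrinsic_leM; first exact: intrinsic_le_refl.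
apply: (big_ind2 (@intrinsic_le X)); first exact: intrinsic_le_refl.
  by move=> *; apply: intrinsic_leM.
by move=> i _; apply: intrinsic_leX.
Qed.

Lemma el1 (x : 'I_n -> X) : el 1 x = \sum_i x i.
Proof.
by rewrite /el big_cards1; apply: eq_bigr => i _; rewrite big_set1.
Qed.

End SemiringPolynomials.

(* With p = x_1^m + ... + x_n^m = r(el_1, ..., el_n), evaluating at (x, 0, ...)
   gives r(t, 0, ...) = t^m for all t; evaluating at (x, y, 0, ...) gives
   x^m + y^m = r(x + y, x y, 0, ...) >= r(x + y, 0, ...) = (x + y)^m. *)
Lemma elementary_frobenius (X : comPzSemiRingType) n :
  upper_bound X -> (2 <= n)%N -> n_elementary X n -> frobenius X.
Proof.
case: n => [|[|n]] // X_ub _ elemX x y m m_gt0.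
pose p : spoly X n.+2 :=
  spoly_sum (fun _ : 'I_n.+2 => 1) (fun i => U_(i) *+ m)%MM.
have pE z: seval p z = \sum_i z i ^+ m.
  rewrite seval_sum; apply: eq_bigr => i _; rewrite mul1r (bigD1 i) //=.
  rewrite mulmnE mnm1E eqxx mul1n big1 ?mulr1 // => j /negPf ij.
  by rewrite mulmnE mnm1E eq_sym ij mul0n.
have p_sym: ssymmetric p.
  move=> s d; rewrite !spoly_sumE (reindex_inj (@perm_inj _ (s^-1)%g)) /=.
  apply: eq_bigl => i; apply/eqP/eqP => /mnmP eq_d; apply/mnmP => j.
    have := eq_d ((s^-1)%g j); rewrite !mulmnE !mnm1E mnmE permKV => <-.
    by rewrite (inj_eq (@perm_inj _ _)).
  rewrite mnmE -eq_d !mulmnE !mnm1E.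
  by rewrite -(inj_eq (@perm_inj _ s)) permKV.
have [r rE] := elemX p p_sym.
pose pt (a b : X) (i : 'I_n.+2) := if val i == 0%N then a else
  if val i == 1%N then b else 0.
have pt_sum a b: \sum_i pt a b i = a + b.
  by rewrite !big_ord_recl /pt /= big1 ?addr0.
have p_pt a b: seval p (pt a b) = a ^+ m + b ^+ m.
  rewrite pE !big_ord_recl /pt /= big1 ?addr0 // => i _.
  by rewrite expr0n eqn0Ngt m_gt0.
apply: X_ub; last exact: addr_expr_le_exprD.
have <-: seval p (pt (x + y) 0) = (x + y) ^+ m.
  by rewrite p_pt expr0n eqn0Ngt m_gt0 addr0.
rewrite -p_pt !rE; apply: seval_le => -[[|i] lt_i].
  by rewrite !el1 !pt_sum addr0; apply: intrinsic_le_refl.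
(* A set of at least two indices contains a nonzero one, where the point [(x + y, 0, ...)] vanishes;
   so the higher elementary symmetric polynomials are 0 there. *)
rewrite [el _ (pt _ 0)]/el big1 => [|h /eqP h_card].
  by exists (el (Ordinal lt_i).+1 (pt x y)); rewrite add0r.
have /subsetPn[j jh]: ~~ (h \subset [set ord0]).
  by apply/negP => /subset_leq_card; rewrite cards1 h_card.
rewrite inE -val_eqE /= => /negPf j0.
by rewrite (bigD1 j) //= /pt j0 if_same mul0r.
Qed.

Lemma cardsE_sum (T : finType) (P : pred T) : #|[set i | P i]| = (\sum_i P i)%N.
Proof.
by rewrite -sum1dep_card big_mkcond; apply: eq_bigr => i _; case: (P i).
Qed.

Lemma sum_ltn_ord N m : (\sum_(k < N) (k < m) = minn N m)%N.
Proof.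
elim: N => [|N IHN]; first by rewrite big_ord0 min0n.
by rewrite big_ord_recr /= IHN; case: (ltnP N m) => /=; lia.
Qed.

(** * Tuples of sets and exchanges of elements *)

Section SetTuples.

Variables n N : nat.
Implicit Types (h : {ffun 'I_N -> {set 'I_n}}) (a b : 'I_n).

(** The exponent of variable [i] in the monomial of [h]. *)
Definition height h i : nat := (\sum_j (i \in h j))%N.

Definition push a b h : {ffun 'I_N -> {set 'I_n}} :=
  [ffun j => if (a \in h j) && (b \notin h j) then b |: (h j :\ a) else h j].

Definition excl a b h : nat := (\sum_j ((a \in h j) && (b \notin h j)))%N.

Definition both a b h : nat := (\sum_j ((a \in h j) && (b \in h j)))%N.

(** A convex potential: it grows when exponents become more unequal. *)
Definition energy h : nat := (\sum_i height h i ^ 2)%N.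

Definition chain h :=
  [forall j : 'I_N, forall k : 'I_N, (j <= k)%N ==> (h k \subset h j)].

Lemma chainP h :
  reflect (forall j k : 'I_N, (j <= k)%N -> h k \subset h j) (chain h).
Proof.
apply: (iffP forallP) => [H j k jk|H j].
  by have /forallP/(_ k)/implyP := H j; apply.
by apply/forallP => k; apply/implyP; apply: H.
Qed.

Lemma both_sym a b h : both a b h = both b a h.
Proof. by apply: eq_bigr => j _; rewrite andbC. Qed.

Lemma height_split a b h : height h a = (both a b h + excl a b h)%N.
Proof.
rewrite -big_split; apply: eq_bigr => j _.
by case: (a \in h j); case: (b \in h j).
Qed.

Lemma card_push a b h j : #|push a b h j| = #|h j|.
Proof.
rewrite ffunE; case: ifP => // /andP[aj bj].
by rewrite cardsU1 !inE (negPf bj) andbF [RHS](cardsD1 a) aj.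
Qed.

Lemma height_push_src a b h : a != b -> height (push a b h) a = both a b h.
Proof.
move=> /negPf ab; apply: eq_bigr => j _; rewrite ffunE.
by case: ifP; [rewrite !inE ab eqxx => /andP[-> /negPf->]|];
  case: (a \in h j); case: (b \in h j).
Qed.

Lemma height_push_dst a b h : a != b ->
  height (push a b h) b = (both a b h + (excl a b h + excl b a h))%N.
Proof.
move=> /negPf ab; rewrite -!big_split; apply: eq_bigr => j _; rewrite ffunE.
by case: ifP; [rewrite !inE eqxx => /andP[-> /negPf->]|];
  case: (a \in h j); case: (b \in h j).
Qed.

Lemma height_push_other a b h i : i != a -> i != b ->
  height (push a b h) i = height h i.
Proof.
move=> /negPf ia /negPf ib; apply: eq_bigr => j _; rewrite ffunE.
by case: ifP => // _; rewrite !inE ia ib.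
Qed.

Lemma energy_bound h : (energy h <= n * N ^ 2)%N.
Proof.
rewrite -[n in leqRHS]card_ord -sum_nat_const leq_sum // => i _.
rewrite leq_sqr -[N]card_ord -sum1_card leq_sum // => j _.
by case: (i \in h j).
Qed.

(** With [c] common and [e], [f] exclusive occurrences, [(c + e)^2 + (c + f)^2] becomes
    [c^2 + (c + e + f)^2], a gain of [2ef]. *)
Lemma energy_push a b h : a != b -> (0 < excl a b h)%N -> (0 < excl b a h)%N ->
  (energy h < energy (push a b h))%N.
Proof.
move=> ab ha hb.
have energyE g : energy g = (height g a ^ 2 + (height g b ^ 2 +
    \sum_(i | (i != a) && (i != b)) height g i ^ 2))%N.
  by rewrite /energy (bigD1 a) //= (bigD1 b) 1?eq_sym.
rewrite !energyE height_push_src // height_push_dst //.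
under [in ltnRHS]eq_bigr => i /andP[ia ib] do rewrite height_push_other //.
rewrite (height_split a b) (height_split b a) (both_sym b a).
rewrite !addnA ltn_add2r -!mulnn; nia.
Qed.

(** * Monomials of set tuples and their absorption *)

Section Monomial.

Variables (X : comPzSemiRingType) (x : 'I_n -> X).

Definition tuple_mon h : X := \prod_j \prod_(i in h j) x i.

Lemma tuple_monE h : tuple_mon h = \prod_i x i ^+ height h i.
Proof.
rewrite /tuple_mon; under eq_bigr do rewrite big_mkcond.
rewrite exchange_big; apply: eq_bigr => i _.
by rewrite expr_sum; apply: eq_bigr => j _; case: (i \in h j).
Qed.

Lemma tuple_mon_push a b h : a != b ->
  tuple_mon (push a b h) =
    x a ^+ both a b h * x b ^+ both a b h *
    (\prod_(i | (i != a) && (i != b)) x i ^+ height h i) *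
    x b ^+ (excl a b h + excl b a h).
Proof.
move=> ab; rewrite tuple_monE (bigD1 a) //= (bigD1 b) 1?eq_sym //=.
rewrite height_push_src // height_push_dst //.
under eq_bigr => i /andP[ia ib] do rewrite height_push_other //.
by rewrite exprD -!mulrA; congr (_ * (_ * _)); rewrite mulrC.
Qed.

Lemma tuple_mon_split a b h : a != b ->
  tuple_mon h =
    x a ^+ both a b h * x b ^+ both a b h *
    (\prod_(i | (i != a) && (i != b)) x i ^+ height h i) *
    (x a ^+ excl a b h * x b ^+ excl b a h).
Proof.
move=> ab; rewrite tuple_monE (bigD1 a) //= (bigD1 b) 1?eq_sym //=.
rewrite (height_split a b) (height_split b a) (both_sym b a) !exprD.
by rewrite mulrA mulrACA mulrAC.
Qed.

(** After removal of a common factor the monomials are [x b ^+ (e + f)], [x a ^+ (e + f)] and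
    [x a ^+ e * x b ^+ f], as in [frobenius_absorb]. *)
Lemma push_absorb a b h : upper_bound X -> frobenius X ->
  a != b -> (0 < excl a b h)%N -> (0 < excl b a h)%N ->
  tuple_mon (push a b h) + tuple_mon (push b a h) + tuple_mon h =
  tuple_mon (push a b h) + tuple_mon (push b a h).
Proof.
move=> X_ub frobX ab ha hb.
rewrite (tuple_mon_push _ ab) (tuple_mon_split h ab) tuple_mon_push 1?eq_sym //.
rewrite (both_sym b a) [x b ^+ both _ _ _ * x a ^+ _]mulrC.
rewrite [\prod_(i | (i != b) && _) _](eq_bigl _ _ (fun i => andbC _ _)).
rewrite -!mulrDr [(excl b a h + _)%N]addnC [x b ^+ _ + x a ^+ _]addrC.
by rewrite frobenius_absorb.
Qed.

Variable c : 'I_N -> nat.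
Hypothesis c_anti : forall j k : 'I_N, (j <= k)%N -> (c k <= c j)%N.

Definition sized h := [forall j, #|h j| == c j].

Lemma sized_push a b h : sized h -> sized (push a b h).
Proof. by move=> /forallP ch; apply/forallP => j; rewrite card_push. Qed.

Lemma nonchain_excl h : sized h -> ~~ chain h ->
  exists2 ab : 'I_n * 'I_n, ab.1 != ab.2 &
    [/\ (0 < excl ab.1 ab.2 h)%N, (0 < excl ab.2 ab.1 h)%N
      & push ab.1 ab.2 h != push ab.2 ab.1 h].
Proof.
move=> /forallP ch /forallPn[j /forallPn[k]]; rewrite negb_imply.
move=> /andP[jk hkj].
have [b bk bj] := subsetPn hkj.
(* As [h k] is no larger than [h j], an inclusion of [h j] in [h k] would be an equality. *)
have /subsetPn[a aj ak]: ~~ (h j \subset h k).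
  apply: contra hkj => hjk.
  by rewrite -(eqP (_ : h j == h k)) // eqEcard hjk (eqP (ch j))
     (eqP (ch k)) c_anti.
exists (a, b); rewrite /=; first by apply: contraNneq bj => <-.
split.
- by rewrite /excl (bigD1 j) //= aj bj.
- by rewrite /excl (bigD1 k) //= ak bk.
(* At [j] the first push contains [b], while the second leaves [h j] unchanged. *)
- apply: contraNneq (bj) => /ffunP/(_ j); rewrite !ffunE aj bj /=.
  by rewrite (negPf bj) /= => /setP/(_ b); rewrite !inE eqxx (negPf bj).
Qed.

(* Induction on the energy: both pushes of h have larger energy than h, so each
   of them is either a chain or already absorbed. *)
Lemma nonchain_absorb h : upper_bound X -> frobenius X ->
  sized h -> ~~ chain h ->
  \sum_(g | sized g && chain g) tuple_mon g + tuple_mon h =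
  \sum_(g | sized g && chain g) tuple_mon g.
Proof.
move=> X_ub frobX; have [e] := ubnP (n * N ^ 2 - energy h)%N.
elim: e h => // e IHe h lt_e ch nh.
have [[a b] /= ab [ha hb push_neq]] := nonchain_excl ch nh.
set L := \sum_(g | _) _.
have ba: b != a by rewrite eq_sym.
have IH u v : u != v -> (0 < excl u v h)%N -> (0 < excl v u h)%N ->
    ~~ chain (push u v h) -> L + tuple_mon (push u v h) = L.
  move=> uv hu hv; apply: IHe; last exact: sized_push.
  have := energy_push uv hu hv; have := energy_bound (push u v h); lia.
have sa := sized_push a b ch; have sb := sized_push b a ch.
(* A push that is a chain is already a summand of [L]; any other can be added to [L] without
   changing it, by induction. Two chain pushes are distinct summands by [push_neq]. *)
suff [R LE]: exists R, L = tuple_mon (push a b h) + tuple_mon (push b a h) + R.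
  by rewrite LE addrAC push_absorb.
have [ca|na] := boolP (chain (push a b h)).
  have [R RE] : exists R, L = tuple_mon (push a b h) + R.
    by rewrite /L (bigD1 (push a b h)) ?sa //=; eexists.
  have [cb|nb] := boolP (chain (push b a h)).
    rewrite /L (bigD1 (push a b h)) ?sa //= (bigD1 (push b a h)) /=.
      by rewrite addrA; eexists.
    by rewrite sb cb eq_sym push_neq.
  by exists R; rewrite addrAC -RE IH.
have [cb|nb] := boolP (chain (push b a h)).
  have [R RE] : exists R, L = tuple_mon (push b a h) + R.
    by rewrite /L (bigD1 (push b a h)) ?sb //=; eexists.
  by exists R; rewrite -addrA addrC -RE IH.
by exists L; rewrite addrC addrA !IH.
Qed.

Lemma prod_el_chain : upper_bound X -> frobenius X ->
  \prod_j el (c j) x = \sum_(h | sized h && chain h) tuple_mon h.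
Proof.
move=> X_ub frobX.
rewrite /el (bigA_distr_big_dep (fun j (A : {set 'I_n}) => #|A| == c j)) /=.
rewrite (eq_bigl sized); last by move=> h; apply/familyP/forallP.
rewrite (bigID chain) /=.
elim/big_rec: (X in _ + X) => [|h s /andP[sh ch] IHs]; first by rewrite addr0.
by rewrite [_ + s]addrC addrA IHs nonchain_absorb.
Qed.

End Monomial.

(** * Exponent vectors as chains of level sets *)

Definition slices (d : {ffun 'I_n -> 'I_N.+1}) : {ffun 'I_N -> {set 'I_n}} :=
  [ffun j : 'I_N => [set i | (j < d i)%N]].

Lemma slices_chain d : chain (slices d).
Proof.
apply/chainP => j k jk; apply/subsetP => i; rewrite !ffunE !inE.
exact: leq_ltn_trans.
Qed.

Lemma height_slices d i : height (slices d) i = d i.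
Proof.
rewrite /height; under eq_bigr do rewrite ffunE inE.
by rewrite sum_ltn_ord; have := ltn_ord (d i); lia.
Qed.

(** In a chain the indices of the sets containing [i] form an initial segment, so their number
    determines them. *)
Lemma height_chain h i (j : 'I_N) : chain h -> (j < height h i)%N = (i \in h j).
Proof.
move=> /chainP ch; apply/idP/idP => [|ij]; last first.
  have <-: (\sum_(k < N) (k < j.+1) = j.+1)%N.
    by rewrite sum_ltn_ord; have := ltn_ord j; lia.
  apply: leq_sum => k _; rewrite ltnS; case: (leqP k j) => // kj.
  by rewrite (subsetP (ch _ _ kj) _ ij).
apply: contraTT => ij; rewrite -leqNgt.
have <-: (\sum_(k < N) (k < j) = j)%N.
  by rewrite sum_ltn_ord; have := ltn_ord j; lia.
apply: leq_sum => k _; case: (ltnP k j) => [|jk]; first by case: (i \in h k).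
by case: (boolP (i \in h k)) => // /(subsetP (ch _ _ jk)); rewrite (negPf ij).
Qed.

Lemma height_lt h i : (height h i < N.+1)%N.
Proof.
rewrite ltnS -[N]card_ord -sum1_card leq_sum // => j _.
by case: (i \in h j).
Qed.

Definition heights h : {ffun 'I_n -> 'I_N.+1} :=
  [ffun i => Ordinal (height_lt h i)].

Lemma slicesK : cancel slices heights.
Proof.
by move=> d; apply/ffunP => i; rewrite ffunE; apply/val_inj/height_slices.
Qed.

Lemma heightsK h : chain h -> slices (heights h) = h.
Proof.
move=> ch; apply/ffunP => j; apply/setP => i.
by rewrite ffunE inE ffunE /= height_chain.
Qed.

Lemma prod_el_slices (X : comPzSemiRingType) (x : 'I_n -> X) (c : 'I_N -> nat) :
  upper_bound X -> frobenius X ->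
  (forall j k : 'I_N, (j <= k)%N -> (c k <= c j)%N) ->
  \prod_j el (c j) x = \sum_(d | sized c (slices d)) \prod_i x i ^+ d i.
Proof.
move=> X_ub frobX c_anti; rewrite (prod_el_chain _ c_anti) //.
rewrite (reindex_onto slices heights) => [|h /andP[_]]; last exact: heightsK.
apply: eq_big => [d|d _]; first by rewrite slicesK eqxx slices_chain !andbT.
by rewrite tuple_monE; apply: eq_bigr => i _; rewrite height_slices.
Qed.

(** Slice sizes count the entries above each level; differences of consecutive counts give the
    multiplicity of each value, so both vectors have the same multiset of entries. *)
Lemma slices_perm (d d' : {ffun 'I_n -> 'I_N.+1}) :
  (forall j, #|slices d j| = #|slices d' j|) ->
  exists s : 'S_n, forall i, d' i = d (s i).
Proof.
move=> eq_sl.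
have eq_gt v: (\sum_i (v < d i) = \sum_i (v < d' i))%N.
  have [v_lt|v_ge] := ltnP v N.
    by have := eq_sl (Ordinal v_lt); rewrite !ffunE !cardsE_sum.
  by rewrite !big1 // => i _; rewrite ltnNge -ltnS (leq_trans (ltn_ord _)).
have eq_ge v: (\sum_i (v <= d i) = \sum_i (v <= d' i))%N.
  by case: v => [|v]; [apply: eq_bigr | apply: eq_gt].
have countE (f : {ffun 'I_n -> 'I_N.+1}) v:
    (count_mem v [tuple f i | i < n] + \sum_i (v < f i) = \sum_i (v <= f i))%N.
  rewrite -sum1_count big_map big_mkcond big_enum -big_split /=.
  by apply: eq_bigr => i _; rewrite -val_eqE /=; case: ltngtP.
have /tuple_permP[s eq_d]: perm_eq [tuple d' i | i < n] [tuple d i | i < n].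
  apply/allP => v _; apply/eqP.
  by have := countE d v; have := countE d' v; rewrite eq_gt eq_ge /=; lia.
exists s => i; have := congr1 (fun t => tnth t i) (val_inj eq_d).
by rewrite !tnth_mktuple.
Qed.

End SetTuples.

(** * Frobenius semirings are fully elementary *)

Lemma el0 (X : comPzSemiRingType) n (x : 'I_n -> X) : el 0 x = 1.
Proof.
rewrite /el (big_pred1 set0) ?big_set0 // => A; exact: cards_eq0.
Qed.

(** Exponent vectors are grouped by their slice sizes [key]. On each class the coefficient of [p] is
    constant by symmetry, and the monomials sum to a product of elementary symmetric polynomials. *)
Lemma frobenius_elementary (X : comPzSemiRingType) :
  upper_bound X -> frobenius X -> fully_elementary X.
Proof.
move=> X_ub frobX n p p_sym; have [N pE] := seval_bounded p.
pose mon (d : {ffun 'I_n -> 'I_N.+1}) := [multinom d i : nat | i < n].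
pose key (d : {ffun 'I_n -> 'I_N.+1}) : {ffun 'I_N -> 'I_n.+1} :=
  [ffun j => inord #|slices d j|].
have keyE d j: key d j = #|slices d j| :> nat.
  by rewrite ffunE inordK // ltnS -[n in leqRHS]card_ord max_card.
(* The coefficient is read off any representative; the default 0 covers size vectors with an empty
   class. *)
pose a (c : {ffun 'I_N -> 'I_n.+1}) : X :=
  if [pick d | key d == c] is Some d then p (mon d) else 0.
(* Variable [i] stands for [el i.+1], so its exponent counts the [j] with [c j = i.+1]; entries
   [c j = 0] give the factor [el 0 x = 1]. *)
exists (spoly_sum a
  (fun c => [multinom (\sum_j (c j == i.+1 :> nat))%N | i < n])).
move=> x; rewrite pE seval_sum (partition_big key xpredT) //=.
apply: eq_bigr => c _; rewrite /a.
case: pickP => [d0 /eqP d0c|c_none]; last first.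
  by rewrite mul0r big_pred0.
have sizedE d: sized (fun j => c j) (slices d) = (key d == c).
  apply/forallP/eqP => [sd|<- j]; last by rewrite keyE.
  by apply/ffunP => j; apply/val_inj; rewrite /= keyE (eqP (sd j)).
transitivity (p (mon d0) * \prod_j el (c j) x); last first.
  congr (_ * _); under [RHS]eq_bigr do rewrite mnmE expr_sum.
  rewrite exchange_big /=; apply: eq_bigr => j _.
  case: (c j) => -[|k] lt_k /=; first by rewrite el0 big1.
  rewrite (bigD1 (Ordinal (lt_k : (k < n)%N))) //= eqxx big1 ?mulr1 // => i.
  by rewrite -val_eqE /= eqSS eq_sym => /negPf->.
rewrite (prod_el_slices _ X_ub frobX); last first.
  move=> j k jk; rewrite -d0c !keyE subset_leq_card //.
  by have /chainP := slices_chain d0; apply.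
rewrite big_distrr (eq_bigl _ _ sizedE); apply: eq_bigr => d /eqP dc.
congr (_ * _); have [|s dE] := @slices_perm _ _ d0 d.
  by move=> j; rewrite -!keyE d0c dc.
rewrite -(p_sym s (mon d0)); congr (p _); apply/mnmP => i.
by rewrite !mnmE dE.
Qed.

Theorem theorem4p7 (X : comPzSemiRingType) (hX : upper_bound X) :
  [<-> frobenius X;
       fully_elementary X;
       exists2 n : nat, (2 <= n)%N & n_elementary X n;
       n_elementary X 2]
  /\
  (linearly_ordered X ->
   [<-> [/\ frobenius X,
            fully_elementary X,
            exists2 n : nat, (2 <= n)%N & n_elementary X n
          & n_elementary X 2];
        supertropical X;
        quasiidempotent X;
        2%:R = 3%:R :> X]).
Proof.
have elem := frobenius_elementary hX; split=> [|X_lin].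
  tfae=> [//|full|[n n_gt1 elem_n]|elem_2]; first by exists 2.
    exact/elem/(elementary_frobenius hX n_gt1).
  exact: elementary_frobenius elem_2.
tfae=> [[frobX _ _ _]|[]//|quasi|two_three].
- exact/(linear_supertropical hX)/frobenius_two_three.
- exact: quasiidempotent_two_three.
- have frobX := linear_frobenius hX X_lin two_three.
  by split=> //; [apply: elem | exists 2 => //; apply: elem | apply: elem].
Qed.
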